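(* Let $1<p<\infty$ and $0<q<p$. There is a constant $C=C(p,q)$ such that for every complex $M\times N$ matrix $A$, $$\frac1C\, h(A)\le h_{p,q}(A)\le C\, h(A).$$
   Context: Let $(\Omega,\Sigma,\mathbb P)$ be a probability space with a dyadic filtration $(\Sigma_k)_{k\ge0}$ (increasing sub-$\sigma$-algebras, each $\Sigma_k$ atomic with exactly $2^k$ atoms of probability $2^{-k}$). Let $\mathcal E_kf=\mathbb E(f\mid\Sigma_k)$ and $\Delta_kf=\mathcal E_kf-\mathcal E_{k-1}f$ for $k\ge1$. For a complex $M\times N$ matrix $A=(a_{jk})$: $h(A)$ is the least constant such that $\big\|\max_{1\le j\le M}|\sum_{k=1}^N a_{jk}\Delta_kf|\big\|_{L_2}\le h(A)\|f\|_{L_2}$ for all $f\in L_2(\Omega)$; and for $0<q<p<\infty$, $h_{p,q}(A)$ is the least constant such that $\big\|\max_{1\le j\le M}|\sum_{k=1}^N a_{jk}\Delta_kf|\big\|_{L_q}\le h_{p,q}(A)\|f\|_{L_p}$ for all $f\in L_p(\Omega)$. These constants do not depend on the choice of probability space and dyadic filtration. *)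

(* Defs.v *)
From HB Require Import structures.
From mathcomp Require Import all_boot all_order all_algebra.
From mathcomp Require Import all_classical all_reals all_analysis.
From mathcomp Require Import complex.
Set Implicit Arguments. Unset Strict Implicit. Unset Printing Implicit Defensive.
Import Order.TTheory GRing.Theory Num.Theory.
Local Open Scope classical_set_scope.
Local Open Scope ring_scope.
Local Open Scope complex_scope.

(* Model: Omega = [0,1) with Lebesgue measure, Sigma_k generated by the
   2^k dyadic intervals [n/2^k,(n+1)/2^k). *)
Section Dyadic.
Variable R : realType.

Definition Omega : set R := `[0%R, 1%R[%classic.

Lemma measurable_Omega : measurable Omega.
Proof. exact: measurable_itv. Qed.

Definition Prob := mrestr (@lebesgue_measure R) measurable_Omega.

Definition dyadic_atom (k : nat) (x : R) : set R :=
  let n : R := (Num.floor (x * 2 ^+ k))%:~R in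
  `[n / 2 ^+ k, (n + 1) / 2 ^+ k[%classic.

Definition cintegral (S : set R) (f : R -> R[i]) : R[i] :=
  (Rintegral (@lebesgue_measure R) S (fun x => complex.Re (f x)))
    +i* (Rintegral (@lebesgue_measure R) S (fun x => complex.Im (f x))).

(* E_k f = E(f | Sigma_k): average of f over the dyadic atom of level k *)
Definition condE (k : nat) (f : R -> R[i]) (x : R) : R[i] :=
  (2 ^+ k)%:C * cintegral (dyadic_atom k x) f.

(* Delta_k f = E_k f - E_{k-1} f  (used for k >= 1) *)
Definition mdiff (k : nat) (f : R -> R[i]) (x : R) : R[i] :=
  condE k f x - condE k.-1 f x.

(* max_{1<=j<=M} | sum_{k=1}^N a_{jk} Delta_k f | ;
   row j : 'I_M stands for j+1 and column k : 'I_N for k+1 *)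
Definition maxop (M N : nat) (A : 'M[R[i]]_(M, N)) (f : R -> R[i]) (x : R) : R :=
  \big[Num.max/0]_(j < M) ComplexField.Normc.normc (\sum_(k < N) A j k * mdiff k.+1 f x).

Definition Lpnorm (p : R) (g : R -> R) : \bar R :=
  Lnorm Prob p%:E (EFin \o g).

Definition inLp (p : R) (f : R -> R[i]) : Prop :=
  [/\ measurable_fun Omega (fun x => complex.Re (f x)),
      measurable_fun Omega (fun x => complex.Im (f x)) &
      (Lpnorm p (fun x => ComplexField.Normc.normc (f x)) < +oo)%E].

Definition admissible (p q : R) (M N : nat) (A : 'M[R[i]]_(M, N)) (C : R) : Prop :=
  0 <= C /\ forall f, inLp p f ->
    (Lpnorm q (maxop A f) <= C%:E * Lpnorm p (fun x => ComplexField.Normc.normc (f x)))%E.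

(* h_{p,q}(A): the least such constant (+oo if none) *)
Definition hpq (p q : R) (M N : nat) (A : 'M[R[i]]_(M, N)) : \bar R :=
  ereal_inf [set C%:E | C in admissible p q A].

Definition h (M N : nat) (A : 'M[R[i]]_(M, N)) : \bar R := hpq 2 2 A.

End Dyadic.

(* Main.v *)
(** Both inequalities follow from one extrapolation principle: if the maximal
    operator of [A] is bounded from [L_p0] to [L_q0] with constant [C], for some
    [p0, q0 > 0], then it is bounded on [L_s] with constant [K(q0, s) * C] for
    every [s > 1].  On [L_s] only [E_N f] matters, so the question is about
    functions on binary words of length [N].

    Placing copies of a function on all dyadic intervals of a generation shows
    that the truncated transforms, starting at that generation, inherit the
    bound, and testing on a Rademacher function gives [|a_k| <= C].  Let [T*] be
    the maximal function of the partial sums.  If [|F_m| > l] at a stopping time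
    [m], then one of [F] and its reflection [2 F_m - F] exceeds [l] at the end;
    hence [T*] satisfies a weak type bound on bounded functions even for
    [q0 < 1], where Doob's inequality is not available.  Stopping [f] when the
    conditional expectation of [|f|] exceeds [k] replaces [f] by a function
    bounded by [2 k], and this yields the good-lambda inequality
      P(T* f > 3 l, M f <= k) <= 2 (6 C k / l)^q0 P(T* f > l)  if C k <= l,
    with [M] the Doob maximal function.  Taking [k] proportional to [l / C],
    summing over the levels [l = 3 ^ j * mu] with weights [l ^ s] and using
    Doob's inequality gives the [L_s] bound. *)
Require Import Defs.
From mathcomp Require Import all_boot all_order all_algebra.
From mathcomp Require Import all_classical all_reals all_analysis.
From mathcomp Require Import measurable_realfun complex.
From mathcomp Require Import ring lra.
Set Implicit Arguments.
Unset Strict Implicit.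
Unset Printing Implicit Defensive.
Import Order.TTheory GRing.Theory Num.Theory ComplexField.Normc.
Local Open Scope ring_scope.
Local Arguments normc {R}.

(** * Powers and moduli *)

Section Power.
Variable R : realType.
Implicit Types r x y : R.

Lemma le_powR2r r x y : 0 <= r -> 0 <= x -> x <= y -> x `^ r <= y `^ r.
Proof.
by move=> r0 x0 xy; rewrite ge0_ler_powR ?nnegrE// (le_trans x0 xy).
Qed.

Lemma powRVK r x : r != 0 -> 0 <= x -> (x `^ r^-1) `^ r = x.
Proof. by move=> r0 x0; rewrite -powRrM mulVf// powRr1. Qed.

Lemma powRKV r x : r != 0 -> 0 <= x -> (x `^ r) `^ r^-1 = x.
Proof. by move=> r0 x0; rewrite -powRrM divff// powRr1. Qed.

Lemma powR_gt1 r x : 0 < r -> 1 < x -> 1 < x `^ r.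
Proof.
move=> r0 x1; suff : (1 : R) `^ r < x `^ r by rewrite powR1.
by rewrite gt0_ltr_powR ?nnegrE ?ler01 ?(ltW (lt_trans ltr01 x1)).
Qed.

Lemma exists_powR_le r x : 0 < r -> 0 < x ->
  exists2 y, 0 < y <= 1 & y `^ r <= x.
Proof.
move=> r0 x0; exists (Num.min 1 (x `^ r^-1)).
  by rewrite lt_min ltr01 powR_gt0//= ge_min lexx.
rewrite -[leRHS](@powRVK r) ?gt_eqF ?(ltW x0)//.
apply: le_powR2r; rewrite ?(ltW r0) ?le_min ?ler01 ?powR_ge0//.
by rewrite ge_min lexx orbT.
Qed.

Lemma powR_tangent r x y : 1 <= r -> 0 <= x -> 0 <= y ->
  r * y `^ (r - 1) * x <= x `^ r + (r - 1) * y `^ r.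
Proof.
move=> r1 x0 y0; move: r1; rewrite le_eqVlt => /predU1P[<-|r1].
  by rewrite subrr powRr0 mul0r powRr1// !mul1r addr0.
have r0 : 0 < r by lra.
have r10 : 0 < r - 1 by lra.
have conj : r^-1 + (r / (r - 1))^-1 = 1 by field; rewrite !gt_eqF.
have := conjugate_powR x0 (powR_ge0 y (r - 1)) r0 (divr_gt0 r0 r10) conj.
rewrite -powRrM mulrCA divff ?gt_eqF// mulr1 -(ler_pM2l r0).
have -> : r * (x * y `^ (r - 1)) = r * y `^ (r - 1) * x by ring.
have -> : r * (x `^ r / r + y `^ r / (r / (r - 1))) = x `^ r + (r - 1) * y `^ r.
  by field; rewrite !gt_eqF.
by [].
Qed.

(* Averaging [powR_tangent] over [x], with [y] the mean of [x], gives the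
   hypothesis; the conclusion is then Jensen's inequality. *)
Lemma powR_le_of_tangent r x y : 1 <= r -> 0 <= y ->
  r * y `^ (r - 1) * y <= x + (r - 1) * y `^ r -> y `^ r <= x.
Proof. by move=> r1 y0; rewrite -mulrA [_ * y]mulrC mulr_powRB1//; lra. Qed.

End Power.

Section Modulus.
Variable R : rcfType.
Implicit Types z : R[i].

Lemma normc_ge0 z : 0 <= normc z.
Proof. by case: z => a b; apply: sqrtr_ge0. Qed.

Lemma normc_nat n : normc (n%:R : R[i]) = n%:R.
Proof. by rewrite normcMn normc1. Qed.

Lemma normc_real (x : R) : normc x%:C%C = `|x|.
Proof. by rewrite /= expr0n addr0 sqrtr_sqr. Qed.

Lemma le_normcB z z' : normc (z - z') <= normc z + normc z'.
Proof. by rewrite -[normc z']normcN le_normcD. Qed.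

Lemma sqr_normc_ReIm z :
  normc z ^+ 2 = complex.Re z ^+ 2 + complex.Im z ^+ 2.
Proof. by case: z => a b; rewrite sqr_sqrtr ?addr_ge0 ?sqr_ge0. Qed.

Lemma normr_Re_le z : `|complex.Re z| <= normc z.
Proof. by case: z => a b /=; rewrite -sqrtr_sqr ler_wsqrtr// lerDl sqr_ge0. Qed.

Lemma normr_Im_le z : `|complex.Im z| <= normc z.
Proof. by case: z => a b /=; rewrite -sqrtr_sqr ler_wsqrtr// lerDr sqr_ge0. Qed.

Lemma le_dot_normc z z' :
  complex.Re z * complex.Re z' + complex.Im z * complex.Im z' <=
  normc z * normc z'.
Proof.
apply: le_trans (ler_norm _) _.
have -> : complex.Re z * complex.Re z' + complex.Im z * complex.Im z' =
    complex.Re (z * z'^*)%C by case: z z' => [a b] [c d] /=; ring.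
have -> : normc z' = normc z'^*%C by case: z' => a b /=; rewrite sqrrN.
by rewrite -normcM normr_Re_le.
Qed.

End Modulus.

(** * Means over binary words *)

Section WordMean.
Variable F : numFieldType.
Implicit Types (n : nat) (f g : seq bool -> F) (c : F).

Fixpoint wmean n f : F :=
  if n is m.+1 then (wmean m (f \o cons true) + wmean m (f \o cons false)) / 2
  else f [::].

Lemma wmeanS n f :
  wmean n.+1 f = (wmean n (f \o cons true) + wmean n (f \o cons false)) / 2.
Proof. by []. Qed.

Lemma eq_wmean n f g :
  (forall w, size w = n -> f w = g w) -> wmean n f = wmean n g.
Proof.
elim: n f g => [|n IH] f g fg /=; first exact: fg.
by congr ((_ + _) / _); apply: IH => w wn /=; apply: fg; rewrite /= wn.
Qed.

Lemma wmean_cst n c : wmean n (fun=> c) = c.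
Proof. by elim: n => //= n IH; rewrite /comp IH; field. Qed.

Lemma wmeanD n f g : wmean n (fun w => f w + g w) = wmean n f + wmean n g.
Proof. by elim: n f g => //= n IH f g; rewrite !IH; field. Qed.

Lemma wmeanZ n c f : wmean n (fun w => c * f w) = c * wmean n f.
Proof. by elim: n f => //= n IH f; rewrite !IH; field. Qed.

Lemma wmeanB n f g : wmean n (fun w => f w - g w) = wmean n f - wmean n g.
Proof. by elim: n f g => //= n IH f g; rewrite !IH; field. Qed.

Lemma wmean_sum n (I : Type) (r : seq I) (f : I -> seq bool -> F) :
  wmean n (fun w => \sum_(j <- r) f j w) = \sum_(j <- r) wmean n (f j).
Proof.
elim: r => [|j r IH].
  by under eq_wmean do rewrite big_nil; rewrite wmean_cst big_nil.
by under eq_wmean do rewrite big_cons; rewrite wmeanD IH big_cons.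
Qed.

Lemma wmean_behead n f : wmean n.+1 (f \o behead) = wmean n f.
Proof. by rewrite [LHS]/= (_ : f \o behead \o _ = f)//; field. Qed.

End WordMean.

Section WordMeanOrder.
Variable R : realFieldType.
Implicit Types (n : nat) (f g : seq bool -> R) (E : pred (seq bool)).

Lemma le_wmean n f g : (forall w, f w <= g w) -> wmean n f <= wmean n g.
Proof.
elim: n f g => [|n IH] f g fg //=.
by rewrite ler_pM2r ?invr_gt0// lerD// IH => // w; apply: fg.
Qed.

Lemma wmean_ge0 n f : (forall w, 0 <= f w) -> 0 <= wmean n f.
Proof. by move=> f0; rewrite -(wmean_cst n 0); apply: le_wmean. Qed.

Lemma wmean_le n f c : (forall w, f w <= c) -> wmean n f <= c.
Proof. by move=> fc; rewrite -[leRHS](wmean_cst n); apply: le_wmean. Qed.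

Definition wprob n E : R := wmean n (fun w => (E w)%:R).

Lemma wprobS n E :
  wprob n.+1 E = (wprob n (E \o cons true) + wprob n (E \o cons false)) / 2.
Proof. by []. Qed.

Lemma wprob_ge0 n E : 0 <= wprob n E.
Proof. by apply: wmean_ge0 => w; rewrite ler0n. Qed.

Lemma wprob_pred0 n E : E =1 xpred0 -> wprob n E = 0.
Proof.
by move=> E0; rewrite -(wmean_cst n 0); apply: eq_wmean => w _; rewrite E0.
Qed.

Lemma wprob_predT n E : E =1 xpredT -> wprob n E = 1.
Proof.
by move=> E1; rewrite -(wmean_cst n 1); apply: eq_wmean => w _; rewrite E1.
Qed.

Lemma le_wprob n E E' : subpred E E' -> wprob n E <= wprob n E'.
Proof.
move=> EE'; apply: le_wmean => w; rewrite ler_nat.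
by case: (boolP (E w)) => // /EE' ->.
Qed.

Lemma eq_wprob n E E' : E =1 E' -> wprob n E = wprob n E'.
Proof. by move=> EE'; apply: eq_wmean => w _; rewrite EE'. Qed.

Lemma wprob_predU n E E' : wprob n (predU E E') <= wprob n E + wprob n E'.
Proof.
rewrite -wmeanD; apply: le_wmean => w /=.
by case: (E w); case: (E' w); rewrite /= ?addr0 ?add0r// lerDl.
Qed.

End WordMeanOrder.
Arguments wprob {R}.

Lemma le_normc_wmean (R : rcfType) n (f : seq bool -> R[i]) :
  normc (wmean n f) <= wmean n (normc \o f).
Proof.
elim: n f => [|n IH] f //=.
rewrite normcM normcV normc_nat ler_pM2r ?invr_gt0//.
by rewrite (le_trans (le_normcD _ _))// lerD//; apply: IH.
Qed.

Section WordNorm.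
Variable R : realType.
Implicit Types (n : nat) (r c : R) (f g : seq bool -> R).

Definition wnorm n r f : R := wmean n (fun w => f w `^ r) `^ r^-1.

Lemma wmean_powR_ge0 n r f : 0 <= wmean n (fun w => f w `^ r).
Proof. by apply: wmean_ge0 => w; apply: powR_ge0. Qed.

Lemma wnorm_ge0 n r f : 0 <= wnorm n r f.
Proof. exact: powR_ge0. Qed.

Lemma powR_wnorm n r f : r != 0 ->
  wnorm n r f `^ r = wmean n (fun w => f w `^ r).
Proof. by move=> r0; rewrite powRVK ?wmean_powR_ge0. Qed.

Lemma eq_wnorm n r f g :
  (forall w, size w = n -> f w = g w) -> wnorm n r f = wnorm n r g.
Proof. by move=> fg; congr powR; apply: eq_wmean => w /fg ->. Qed.

Lemma wnorm_cst n r c : r != 0 -> 0 <= c -> wnorm n r (fun=> c) = c.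
Proof. by move=> r0 c0; rewrite /wnorm wmean_cst powRKV. Qed.

Lemma wnorm_behead n r f : wnorm n.+1 r (f \o behead) = wnorm n r f.
Proof. by rewrite /wnorm -(wmean_behead n (fun w => f w `^ r)). Qed.

Lemma wnormZr n r c f : r != 0 -> 0 <= c -> (forall w, 0 <= f w) ->
  wnorm n r (fun w => f w * c) = wnorm n r f * c.
Proof.
move=> r0 c0 f0; rewrite -[c in RHS](powRKV r0)// mulrC.
rewrite -powRM ?powR_ge0 ?wmean_powR_ge0// -wmeanZ.
congr powR; apply: eq_wmean => w _.
by rewrite powRM// mulrC.
Qed.

Lemma wnorm_le_of_wmean n r c f x : 0 < r -> 0 <= c -> 0 <= x ->
  wmean n (fun w => f w `^ r) <= c `^ r * x -> wnorm n r f <= c * x `^ r^-1.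
Proof.
move=> r0 c0 x0 fx.
rewrite -[c](powRKV (lt0r_neq0 r0))// -powRM ?powR_ge0//.
by rewrite le_powR2r ?invr_ge0 ?(ltW r0) ?wmean_powR_ge0.
Qed.

Lemma le_wnorm n r f g : 0 <= r -> (forall w, 0 <= f w <= g w) ->
  wnorm n r f <= wnorm n r g.
Proof.
move=> r0 fg; apply: le_powR2r; rewrite ?invr_ge0 ?wmean_powR_ge0//.
by apply: le_wmean => w; have /andP[f0 fgw] := fg w; apply: le_powR2r.
Qed.

Lemma jensen_wmean n r f : 1 <= r -> (forall w, 0 <= f w) ->
  wmean n f `^ r <= wmean n (fun w => f w `^ r).
Proof.
move=> r1 f0; have m0 := wmean_ge0 n f0.
apply: powR_le_of_tangent => //; rewrite -wmeanZ.
rewrite -(wmean_cst n ((r - 1) * _)) -wmeanD.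
by apply: le_wmean => w; apply: powR_tangent.
Qed.

Lemma le_wnorm_exponent n r r' f : 0 < r -> r <= r' -> (forall w, 0 <= f w) ->
  wnorm n r f <= wnorm n r' f.
Proof.
move=> r0 rr' f0; have r'0 := lt_le_trans r0 rr'.
rewrite -[leLHS](powRKV (lt0r_neq0 r'0)) ?wnorm_ge0//.
apply: le_powR2r; rewrite ?invr_ge0 ?(ltW r'0) ?powR_ge0//.
have -> : wnorm n r f `^ r' = wmean n (fun w => f w `^ r) `^ (r' / r).
  by rewrite -powRrM mulrC.
apply: le_trans (jensen_wmean _ _ _) _; rewrite ?ler_pdivlMr ?mul1r//.
  by move=> w; apply: powR_ge0.
by apply: le_wmean => w; rewrite -powRrM mulrCA divff ?gt_eqF// mulr1.
Qed.

Lemma markov_wprob n r c f : 0 < r -> 0 < c -> (forall w, 0 <= f w) ->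
  wprob n (fun w => c < f w) <= (wnorm n r f / c) `^ r.
Proof.
move=> r0 c0 f0; rewrite powRM ?wnorm_ge0 ?invr_ge0 ?(ltW c0)//.
rewrite powR_wnorm ?gt_eqF// mulrC -wmeanZ; apply: le_wmean => w.
rewrite -powRM ?invr_ge0 ?(ltW c0)//; case: ltP => cf; last exact: powR_ge0.
apply: (@le_trans _ _ (1 `^ r)); first by rewrite powR1.
apply: le_powR2r; rewrite ?(ltW r0)//.
by rewrite -ler_pdivrMl ?invr_gt0// invrK mulr1 ltW.
Qed.

End WordNorm.

(** * Doob's maximal inequality *)

Section Doob.
Variable R : realType.
Implicit Types (n : nat) (s m x y : R) (g : seq bool -> R) (w : seq bool).

Fixpoint doob_max n g w : R :=
  if n is m.+1 then
    Num.max (wmean m.+1 g) (doob_max m (g \o cons (head true w)) (behead w))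
  else g [::].

Lemma doob_maxS n g w (b := head true w) : doob_max n.+1 g w =
  Num.max (wmean n.+1 g) (doob_max n (g \o cons b) (behead w)).
Proof. by []. Qed.

Lemma le_wmean_doob_max n g w : wmean n g <= doob_max n g w.
Proof. by case: n => //= n; rewrite le_max lexx. Qed.

Lemma doob_max_ge0 n g w : (forall w, 0 <= g w) -> 0 <= doob_max n g w.
Proof.
by move=> g0; apply: le_trans (wmean_ge0 _ _) (le_wmean_doob_max _ _ _).
Qed.

(* Burkholder's function for Doob's inequality: affine in the current value [x]
   of the martingale, and not increased when the running maximum [y] moves up
   to [x]. *)
Definition burkholder s y x : R := y `^ s - s / (s - 1) * y `^ (s - 1) * x.

Lemma le_burkholder_diag s x y : 1 < s -> 0 <= x -> 0 <= y ->
  burkholder s x x <= burkholder s y x.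
Proof.
move=> s1 x0 y0; have s10 : 0 < s - 1 by lra.
have xs : x `^ (s - 1) * x = x `^ s by rewrite mulrC mulr_powRB1//; lra.
rewrite /burkholder -(ler_pM2l s10) -mulrA xs.
have -> : (s - 1) * (x `^ s - s / (s - 1) * x `^ s) = - x `^ s.
  by field; rewrite gt_eqF.
have -> : (s - 1) * (y `^ s - s / (s - 1) * y `^ (s - 1) * x) =
   (s - 1) * y `^ s - s * y `^ (s - 1) * x by field; rewrite gt_eqF.
by have := powR_tangent (ltW s1) x0 y0; lra.
Qed.

Lemma wmean_burkholder_le s n m g : 1 < s -> 0 <= m -> (forall w, 0 <= g w) ->
  wmean n g <= m ->
  wmean n (fun w => burkholder s (Num.max m (doob_max n g w)) (g w)) <=
  burkholder s m (wmean n g).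
Proof.
move=> s1; elim: n m g => [|n IH] m g m0 g0 gm; first by rewrite /= max_l.
pose M b w := Num.max m (doob_max n.+1 g (b :: w)).
suff half b : wmean n (fun w => burkholder s (M b w) (g (b :: w))) <=
    burkholder s m (wmean n (g \o cons b)).
  have -> : burkholder s m (wmean n.+1 g) =
      (burkholder s m (wmean n (g \o cons true)) +
       burkholder s m (wmean n (g \o cons false))) / 2.
    by rewrite /burkholder /=; field; rewrite gt_eqF//; lra.
  by rewrite wmeanS ler_pM2r ?invr_gt0// lerD//; apply: half.
set gb := g \o cons b; have gb0 w : 0 <= gb w by apply: g0.
under eq_wmean => w _ do rewrite /M doob_maxS maxA (max_l gm).
have [gbm|/ltW mgb] := leP (wmean n gb) m; first exact: (IH m gb).
apply: le_trans (le_burkholder_diag s1 (wmean_ge0 _ gb0) m0).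
apply: le_trans (IH _ gb (wmean_ge0 _ gb0) gb0 (lexx _)).
apply: le_wmean => w; have gbM := le_wmean_doob_max n gb w.
by rewrite !max_r// (le_trans mgb gbM).
Qed.

Lemma doob_wmean_le s n g : 1 < s -> (forall w, 0 <= g w) ->
  wmean n (fun w => doob_max n g w `^ s) <=
  (s / (s - 1)) `^ s * wmean n (fun w => g w `^ s).
Proof.
move=> s1 g0; set s' := s / (s - 1).
have s'0 : 0 <= s' by rewrite divr_ge0; lra.
set M := doob_max n g; have M0 w : 0 <= M w by apply: doob_max_ge0.
have burk0 : wmean n (fun w => burkholder s (M w) (g w)) <= 0.
  have e0 := wmean_ge0 n g0.
  have := wmean_burkholder_le s1 e0 g0 (lexx _).
  under eq_wmean => w _ do rewrite max_r ?le_wmean_doob_max//.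
  move=> /le_trans; apply.
  apply: le_trans (le_burkholder_diag s1 e0 (lexx 0)) _.
  by rewrite /burkholder !powR0 ?gt_eqF ?subr_gt0 ?mulr0 ?mul0r ?subrr//; lra.
have : wmean n (fun w => M w `^ s) <=
    wmean n (fun w => s * burkholder s (M w) (g w) + s' `^ s * g w `^ s).
  apply: le_wmean => w; rewrite -powRM//.
  have := powR_tangent (ltW s1) (mulr_ge0 s'0 (g0 w)) (M0 w).
  by rewrite /burkholder -/s'; lra.
rewrite wmeanD !wmeanZ.
by have := ler_wpM2l (ltW (lt_trans ltr01 s1)) burk0; lra.
Qed.

Lemma doob_inequality s n g : 1 < s -> (forall w, 0 <= g w) ->
  wnorm n s (doob_max n g) <= s / (s - 1) * wnorm n s g.
Proof.
move=> s1 g0; apply: wnorm_le_of_wmean; rewrite ?wmean_powR_ge0//; first by lra.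
  by rewrite divr_ge0; lra.
exact: doob_wmean_le.
Qed.

End Doob.

(** * From distributional to norm inequalities *)

Section LayerCake.
Variables (R : realType) (t s : R).
Hypotheses (t_gt1 : 1 < t) (s_gt0 : 0 < s).
Implicit Types (x mu : R) (j J n : nat).

Let t_gt0 : 0 < t := lt_trans ltr01 t_gt1.

Let ts_gt1 : 1 < t `^ s := powR_gt1 s_gt0 t_gt1.

Definition level mu j : R := t ^+ j * mu.

Definition layer_sum mu J x : R :=
  \sum_(j < J) (level mu j < x)%R%:R * level mu j `^ s.

Lemma level_gt0 mu j : 0 < mu -> 0 < level mu j.
Proof. by move=> mu0; rewrite mulr_gt0 ?exprn_gt0. Qed.

Lemma powR_levelS mu j : 0 < mu ->
  level mu j.+1 `^ s = t `^ s * level mu j `^ s.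
Proof.
by move=> mu0; rewrite /level exprS -mulrA powRM ?ltW// (level_gt0 j mu0).
Qed.

Lemma exists_level_ge mu x : 0 < mu -> exists J, x <= level mu J.
Proof.
have bernoulli J : 1 + (t - 1) * J%:R <= t ^+ J.
  elim: J => [|J IH]; first by rewrite mulr0 addr0.
  have t1 : 0 <= t - 1 by rewrite subr_ge0 ltW.
  have := ler_wpM2l t1 (exprn_ege1 J (ltW t_gt1)).
  by rewrite exprS -natr1; lra.
move=> mu0; pose y := x / mu / (t - 1); exists (Num.bound `|y|).
rewrite -ler_pdivrMr//; apply: le_trans (bernoulli _).
have : y < (Num.bound `|y|)%:R.
  by apply: le_lt_trans (archi_boundP (normr_ge0 y)); apply: ler_norm.
by rewrite ltr_pdivrMr ?subr_gt0// mulrC; lra.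
Qed.

Lemma layer_sumS mu J x : layer_sum mu J.+1 x =
  layer_sum mu J x + (level mu J < x)%R%:R * level mu J `^ s.
Proof. by rewrite /layer_sum big_ord_recr. Qed.

Lemma layer_sum_ge0 mu J x : 0 <= layer_sum mu J x.
Proof. by apply: sumr_ge0 => j _; rewrite mulr_ge0 ?ler0n ?powR_ge0. Qed.

Lemma layer_sum_le_level mu J x : 0 < mu ->
  layer_sum mu J x <= level mu J `^ s / (t `^ s - 1).
Proof.
move=> mu0; elim: J => [|J IH].
  by rewrite /layer_sum big_ord0 divr_ge0 ?powR_ge0// subr_ge0 ltW.
rewrite layer_sumS powR_levelS//.
have -> : t `^ s * level mu J `^ s / (t `^ s - 1) =
    level mu J `^ s / (t `^ s - 1) + level mu J `^ s.
  by field; rewrite gt_eqF ?subr_gt0.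
by rewrite lerD//; case: (_ < x); rewrite ?mul1r ?mul0r ?powR_ge0.
Qed.

Lemma layer_sum_le_powR mu J x : 0 < mu -> 0 <= x ->
  layer_sum mu J x <= t `^ s / (t `^ s - 1) * x `^ s.
Proof.
move=> mu0 x0; have ts1 : 0 <= t `^ s - 1 by rewrite subr_ge0 ltW.
elim: J => [|J IH].
  by rewrite /layer_sum big_ord0 mulr_ge0 ?powR_ge0// divr_ge0 ?powR_ge0.
have [Jx|xJ] := ltP (level mu J) x; last first.
  by rewrite layer_sumS ltNge xJ mul0r addr0.
apply: le_trans (layer_sum_le_level _ _ mu0) _; rewrite powR_levelS// mulrAC.
rewrite ler_wpM2l ?divr_ge0 ?powR_ge0//.
by rewrite le_powR2r ?(ltW s_gt0) ?(ltW (level_gt0 _ _))// ltW.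
Qed.

Lemma powR_le_layer_sum mu J x : 0 < mu -> 0 <= x -> x <= level mu J ->
  x `^ s <= mu `^ s + t `^ s * layer_sum mu J x.
Proof.
move=> mu0 x0; elim: J => [|J IH] xJ.
  rewrite /layer_sum big_ord0 mulr0 addr0 le_powR2r ?(ltW s_gt0)//.
  by rewrite /level expr0 mul1r in xJ.
rewrite layer_sumS; have [Jx|/IH] := ltP (level mu J) x; last first.
  by rewrite mul0r addr0.
apply: le_trans (le_powR2r (ltW s_gt0) x0 xJ) _.
rewrite powR_levelS// mul1r mulrDr addrA lerDr addr_ge0 ?powR_ge0//.
by rewrite mulr_ge0 ?powR_ge0 ?layer_sum_ge0.
Qed.

Lemma layer_sum_dilation mu J x : 0 < mu ->
  layer_sum mu J x <= mu `^ s + t `^ s * layer_sum mu J (x / t).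
Proof.
move=> mu0; apply: (@le_trans _ _ (layer_sum mu J.+1 x)).
  by rewrite layer_sumS lerDl mulr_ge0 ?ler0n ?powR_ge0.
rewrite /layer_sum big_ord_recl {1 2}/level expr0 mul1r lerD//.
  by case: (_ < _); rewrite ?mul1r ?mul0r ?powR_ge0.
rewrite mulr_sumr ler_sum// => j _; rewrite lift0 powR_levelS// mulrCA.
have -> : level mu j.+1 = level mu j * t by rewrite /level exprSr mulrAC.
by rewrite ltr_pdivlMr.
Qed.

Lemma wmean_layer_sum n mu J (f : seq bool -> R) :
  wmean n (fun w => layer_sum mu J (f w)) =
  \sum_(j < J) wprob n (fun w => level mu j < f w) * level mu j `^ s.
Proof.
rewrite wmean_sum; apply: eq_bigr => j _; rewrite [RHS]mulrC -wmeanZ.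
by apply: eq_wmean => w _; rewrite mulrC.
Qed.

Variables (n : nat) (X Y : seq bool -> R) (eps c : R).
Hypotheses (X_ge0 : forall w, 0 <= X w) (Y_ge0 : forall w, 0 <= Y w).
Hypotheses (X_bounded : exists B, forall w, X w <= B).
Hypotheses (eps_gt0 : 0 < eps) (c_small : c * t `^ s <= 2^-1).
Hypothesis good_lambda : forall l, 0 < l ->
  wprob n (fun w => (t * l < X w) && (Y w <= eps * l)) <=
  c * wprob n (fun w => l < X w).

Lemma wprob_dilation_le l : 0 < l -> wprob n (fun w => l < X w / t) <=
  c * wprob n (fun w => l < X w) + wprob n (fun w => l < Y w / eps).
Proof.
move=> l0; rewrite -lerBlDr; apply: le_trans (good_lambda l0).
rewrite lerBlDr; apply: le_trans (wprob_predU _ _ _ _); apply: le_wprob => w /=.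
rewrite !ltr_pdivlMr// [l * t]mulrC => -> /=.
by rewrite [l * eps]mulrC; case: leP.
Qed.

Lemma wmean_layer_sum_good_lambda mu J : 0 < mu ->
  wmean n (fun w => layer_sum mu J (X w)) <=
  2 * mu `^ s + 2 * t `^ s * wmean n (fun w => layer_sum mu J (Y w / eps)).
Proof.
move=> mu0; set L := wmean n _; set L' := wmean n _.
have L_le : L <= mu `^ s + t `^ s * (c * L + L').
  apply: le_trans (le_wmean _ (fun w => layer_sum_dilation J (X w) mu0)) _.
  rewrite wmeanD wmean_cst lerD2l wmeanZ ler_wpM2l ?powR_ge0//.
  rewrite /L /L' !wmean_layer_sum mulr_sumr -big_split ler_sum// => j _ /=.
  by rewrite mulrA -mulrDl ler_wpM2r ?powR_ge0// wprob_dilation_le ?level_gt0.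
have L0 : 0 <= L by apply: wmean_ge0 => w; apply: layer_sum_ge0.
by have := ler_wpM2r L0 c_small; lra.
Qed.

Lemma wmean_powR_le_level mu : 0 < mu ->
  wmean n (fun w => X w `^ s) <= (1 + 2 * t `^ s) * mu `^ s +
  2 * t `^ s ^+ 3 / (t `^ s - 1) * wmean n (fun w => (Y w / eps) `^ s).
Proof.
move=> mu0; have ts_ge0 := powR_ge0 t s.
have [B X_le_B] := X_bounded; have [J B_le_level] := exists_level_ge B mu0.
set LX := wmean n (fun w => layer_sum mu J (X w)).
have X_le : wmean n (fun w => X w `^ s) <= mu `^ s + t `^ s * LX.
  rewrite -wmeanZ -(wmean_cst n (mu `^ s)) -wmeanD; apply: le_wmean => w.
  by apply: powR_le_layer_sum => //; apply: le_trans B_le_level.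
have LX_le := wmean_layer_sum_good_lambda J mu0; rewrite -/LX in LX_le.
set EY := wmean n (fun w => (Y w / eps) `^ s).
have LY_le : wmean n (fun w => layer_sum mu J (Y w / eps)) <=
    t `^ s / (t `^ s - 1) * EY.
  rewrite -wmeanZ; apply: le_wmean => w; apply: layer_sum_le_powR => //.
  by rewrite divr_ge0 ?(ltW eps_gt0).
have {}LX_le : LX <= 2 * mu `^ s + 2 * t `^ s * (t `^ s / (t `^ s - 1) * EY).
  by apply: le_trans LX_le _; rewrite lerD2l ler_wpM2l ?mulr_ge0.
apply: le_trans X_le _.
have -> : 2 * t `^ s ^+ 3 / (t `^ s - 1) * EY =
    t `^ s * (2 * t `^ s * (t `^ s / (t `^ s - 1) * EY)).
  by field; rewrite gt_eqF ?subr_gt0.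
by have := ler_wpM2l ts_ge0 LX_le; rewrite mulrDr; lra.
Qed.

Lemma good_lambda_wmean_le :
  wmean n (fun w => X w `^ s) <=
  2 * t `^ s ^+ 3 / (t `^ s - 1) * wmean n (fun w => (Y w / eps) `^ s).
Proof.
apply/ler_addgt0Pr => d d0; rewrite addrC.
have ts2_gt0 : 0 < 1 + 2 * t `^ s by have := ts_gt1; lra.
have d'0 : 0 < d / (1 + 2 * t `^ s) by rewrite divr_gt0.
apply: le_trans (wmean_powR_le_level (powR_gt0 s^-1 d'0)) _.
by rewrite powRVK ?gt_eqF ?(ltW d'0)// [_ * (d / _)]mulrC divfK ?gt_eqF.
Qed.

Definition good_lambda_cst : R :=
  (2 * t `^ s ^+ 3 / (t `^ s - 1)) `^ s^-1.

Lemma good_lambda_cst_gt0 : 0 < good_lambda_cst.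
Proof.
have ts_gt0 := lt_trans ltr01 ts_gt1.
by rewrite powR_gt0 ?divr_gt0 ?mulr_gt0 ?exprn_gt0 ?subr_gt0.
Qed.

Lemma good_lambda_wnorm_le :
  wnorm n s X <= good_lambda_cst * (wnorm n s Y / eps).
Proof.
have -> : wnorm n s Y / eps = wnorm n s (fun w => Y w / eps).
  by rewrite wnormZr ?gt_eqF ?invr_ge0 ?(ltW eps_gt0).
apply: wnorm_le_of_wmean; rewrite ?wmean_powR_ge0 ?powR_ge0//.
rewrite powRVK ?gt_eqF//; first exact: good_lambda_wmean_le.
by rewrite divr_ge0 ?mulr_ge0 ?exprn_ge0 ?powR_ge0 ?subr_ge0 ?(ltW ts_gt1).
Qed.

End LayerCake.

(** * Martingale transforms *)

Section Seminorm.
Variables (R : rcfType) (V : lmodType R[i]).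
Implicit Types nrm : V -> R.

Definition seminorm nrm : Prop :=
  (forall u v, nrm (u + v) <= nrm u + nrm v) /\
  (forall (c : R[i]) v, nrm (c *: v) = normc c * nrm v).

Lemma seminorm0 nrm : seminorm nrm -> nrm 0 = 0.
Proof. by case=> _ nrmZ; rewrite -(scale0r 0) nrmZ normc0 mul0r. Qed.

Lemma seminormN nrm v : seminorm nrm -> nrm (- v) = nrm v.
Proof. by case=> _ nrmZ; rewrite -scaleN1r nrmZ normcN normc1 mul1r. Qed.

Lemma seminorm_ge0 nrm v : seminorm nrm -> 0 <= nrm v.
Proof.
move=> nrmP; have [nrmD _] := nrmP; have := nrmD v (- v).
by rewrite subrr seminorm0// seminormN//; lra.
Qed.

End Seminorm.

Section Transform.
Variables (R : realType) (V : lmodType R[i]).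
Implicit Types (n : nat) (a : nat -> V) (u v : V).
Implicit Types (g : seq bool -> R[i]) (w : seq bool).

Definition transform_step n a v g (b : bool) : V :=
  v + (wmean n (g \o cons b) - wmean n.+1 g) *: a 0%N.

(* [transform n a v g w] is [v + \sum_(k < n) d_k *: a k], where [d_k] is the
   [k]-th martingale difference of [g] along the path [w]. *)
Fixpoint transform n a v g w : V :=
  if n is m.+1 then
    let b := head true w in
    transform m (a \o S) (transform_step m a v g b) (g \o cons b) (behead w)
  else v.

Lemma transformS n a v g w (b := head true w) : transform n.+1 a v g w =
  transform n (a \o S) (transform_step n a v g b) (g \o cons b) (behead w).
Proof. by []. Qed.

Lemma eq_transform n a v g g' w : (forall w, size w = n -> g w = g' w) ->
  size w = n -> transform n a v g w = transform n a v g' w.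
Proof.
elim: n a v g g' w => // n IH a v g g' [//|b w] gg' [wn].
have gg'b c w' : size w' = n -> (g \o cons c) w' = (g' \o cons c) w'.
  by move=> w'n; apply: gg'; rewrite /= w'n.
rewrite !transformS (IH _ _ _ _ _ (gg'b b))//.
by rewrite /transform_step (eq_wmean (gg'b b)) (eq_wmean gg').
Qed.

Lemma transformB n a u v g g' w :
  transform n a (u - v) (fun w => g w - g' w) w =
  transform n a u g w - transform n a v g' w.
Proof.
elim: n a u v g g' w => // n IH a u v g g' w.
have subrACA (x y z t : R[i]) : x - y - (z - t) = x - z - (y - t) by ring.
rewrite !transformS -IH /transform_step !wmeanB; congr transform.
by rewrite [in RHS](opprD v) [RHS]addrACA -[in RHS]scalerBl subrACA.
Qed.

Lemma transform_cst n a v c w : transform n a v (fun=> c) w = v.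
Proof.
elim: n a v w => // n IH a v w.
by rewrite transformS IH /transform_step !wmean_cst subrr scale0r addr0.
Qed.

Variable nrm : V -> R.
Hypothesis nrm_seminorm : seminorm nrm.

Fixpoint transform_max n a v g w : R :=
  if n is m.+1 then
    let b := head true w in
    Num.max (nrm v)
      (transform_max m (a \o S) (transform_step m a v g b) (g \o cons b)
         (behead w))
  else nrm v.

Lemma transform_maxS n a v g w (b := head true w) :
  transform_max n.+1 a v g w = Num.max (nrm v)
    (transform_max n (a \o S) (transform_step n a v g b) (g \o cons b)
       (behead w)).
Proof. by []. Qed.

Lemma le_seminorm_transform_max n a v g w : nrm v <= transform_max n a v g w.
Proof. by case: n => //= n; rewrite le_max lexx. Qed.

Lemma transform_max_ge0 n a v g w : 0 <= transform_max n a v g w.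
Proof.
exact: le_trans (seminorm_ge0 _ _) (le_seminorm_transform_max _ _ _ _ _).
Qed.

Lemma seminorm_transform_le_max n a v g w :
  nrm (transform n a v g w) <= transform_max n a v g w.
Proof. by elim: n a v g w => //= n IH a v g w; rewrite le_max IH orbT. Qed.

Lemma transform_maxD n a u v g w :
  transform_max n a (u + v) g w <= nrm u + transform_max n a v g w.
Proof.
have [nrmD _] := nrm_seminorm.
elim: n a v g w => [|n IH] a v g w /=; first exact: nrmD.
rewrite ge_max; apply/andP; split.
  by rewrite (le_trans (nrmD _ _))// lerD2l le_max lexx.
rewrite {1}/transform_step -addrA (le_trans (IH _ _ _ _))// lerD2l.
by rewrite le_max lexx orbT.
Qed.

Lemma transform_max_bounded n a v g :
  exists B, forall w, transform_max n a v g w <= B.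
Proof.
elim: n a v g => [|n IH] a v g; first by exists (nrm v).
have [B_ B_ge] := choice (fun b =>
  IH (a \o S) (transform_step n a v g b) (g \o cons b)).
exists (Num.max (nrm v) (Num.max (B_ true) (B_ false))) => w /=.
rewrite ge_max !le_max lexx/=.
by case: (head true w); rewrite B_ge ?orbT.
Qed.

Definition Loo_bounded (q H : R) n a : Prop :=
  forall g B, 0 <= B -> (forall w, normc (g w) <= B) ->
    wnorm n q (nrm \o transform n a 0 g) <= H * B.

Lemma Loo_boundedW q H H' n a : H <= H' ->
  Loo_bounded q H n a -> Loo_bounded q H' n a.
Proof.
move=> HH' bnd g B B0 gB.
by apply: le_trans (bnd g B B0 gB) _; rewrite ler_wpM2r.
Qed.

Lemma Loo_bounded_shift q H n a :
  Loo_bounded q H n.+1 a -> Loo_bounded q H n (a \o S).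
Proof.
(* Two copies of [g] side by side have vanishing first difference. *)
move=> bnd g B B0 gB; have := bnd (g \o behead) B B0 (fun w => gB _).
have -> : nrm \o transform n.+1 a 0 (g \o behead) =
    (nrm \o transform n (a \o S) 0 g) \o behead.
  apply/funext => w /=; congr (nrm (transform _ _ _ _ _)).
  by rewrite /transform_step wmean_behead subrr scale0r addr0.
by rewrite wnorm_behead.
Qed.

(* The test function is the first Rademacher function. *)
Lemma Loo_bounded_coef q H n a : 0 < q ->
  Loo_bounded q H n.+1 a -> nrm (a 0%N) <= H.
Proof.
move=> q0 bnd; pose sgn b : R[i] := if b then 1 else - 1.
have normc_sgn b : normc (sgn b) = 1 by case: b; rewrite ?normcN normc1.
have sgn_le1 w : normc (sgn (head true w)) <= 1 by rewrite normc_sgn.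
have := bnd _ 1 ler01 sgn_le1.
have -> : nrm \o transform n.+1 a 0 (fun w => sgn (head true w)) =
    fun=> nrm (a 0%N).
  apply/funext => w /=; rewrite transform_cst /transform_step add0r.
  rewrite [wmean n.+1 _]/= !wmean_cst subrr mul0r subr0.
  by have [_ ->] := nrm_seminorm; rewrite normc_sgn mul1r.
by rewrite wnorm_cst ?gt_eqF ?seminorm_ge0// mulr1.
Qed.

(** * The good-lambda inequality *)

(* [g] reflected about its conditional mean from the first time at which the
   transform exceeds [l]. *)
Fixpoint reflected (l : R) n a v g w : R[i] :=
  if n is m.+1 then
    if l < nrm v then 2 * wmean m.+1 g - g w else
    let b := head true w in
    reflected l m (a \o S) (transform_step m a v g b) (g \o cons b) (behead w)
  else g [::].

Lemma reflected_gt l n a v g : l < nrm v ->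
  reflected l n.+1 a v g = fun w => 2 * wmean n.+1 g - g w.
Proof. by move=> lv; apply/funext => w; rewrite /= lv. Qed.

Lemma reflected_cons l n a v g b : nrm v <= l ->
  reflected l n.+1 a v g \o cons b =
  reflected l n (a \o S) (transform_step n a v g b) (g \o cons b).
Proof. by move=> vl; apply/funext => w; rewrite /= ltNge vl. Qed.

Lemma wmean_reflected l n a v g : wmean n (reflected l n a v g) = wmean n g.
Proof.
elim: n a v g => // n IH a v g; have [vl|lv] := leP (nrm v) l.
  by rewrite wmeanS !reflected_cons// !IH.
by rewrite reflected_gt// wmeanB wmean_cst; ring.
Qed.

Lemma normc_reflected l n a v g B w : (forall w, normc (g w) <= B) ->
  normc (reflected l n a v g w) <= 3 * B.
Proof.
move=> gB; have B0 : 0 <= B := le_trans (normc_ge0 _) (gB [::]).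
elim: n a v g w gB => [|n IH] a v g w gB /=.
  by apply: le_trans (gB _) _; lra.
case: ifP => _; last by apply: IH => w'; apply: gB.
apply: le_trans (le_normcB _ _) _; rewrite normcM normc_nat.
have : normc (wmean n.+1 g) <= B.
  by apply: le_trans (le_normc_wmean _ _) (wmean_le _ _).
by have := gB w; rewrite -wmeanS; lra.
Qed.

Lemma transform_reflected_gt l n a v g w : l < transform_max n a v g w ->
  (l < nrm (transform n a v g w)) ||
  (l < nrm (transform n a v (reflected l n a v g) w)).
Proof.
elim: n a v g w => [|n IH] a v g w; first by move=> /= ->.
have [vl|lv _] := leP (nrm v) l.
  rewrite transform_maxS lt_max ltNge vl => /IH.
  set b := head true w; set u := transform_step n a v g b.
  suff -> : transform n.+1 a v (reflected l n.+1 a v g) w =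
      transform n (a \o S) u (reflected l n (a \o S) u (g \o cons b))
        (behead w) by [].
  rewrite transformS -/b {1}/transform_step wmean_reflected.
  by rewrite reflected_cons// wmean_reflected.
have := transformB n.+1 a (v + v) v (fun=> 2 * wmean n.+1 g) g w.
rewrite addrK transform_cst -(reflected_gt n a g lv) => ->.
set x := transform _ _ _ _ _; rewrite -[_ || _]negbK negb_or -!leNgt.
apply/negP => /andP[xl vxl]; have [nrmD nrmZ] := nrm_seminorm.
have := nrmD x (v + v - x); have -> : x + (v + v - x) = (2 : R[i]) *: v.
  by rewrite addrC addrNK scaler_nat mulr2n.
by rewrite nrmZ normc_nat; lra.
Qed.

(* Reflection replaces Doob's inequality, which is not available for
   [q <= 1]. *)
Lemma weak_type_transform_max q H n a g B l : 0 < q -> 0 <= B -> 0 < l ->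
  Loo_bounded q H n a -> (forall w, normc (g w) <= B) ->
  wprob n (fun w => l < transform_max n a 0 g w) <= 2 * (3 * H * B / l) `^ q.
Proof.
move=> q0 B0 l0 bnd gB.
have tail g' : (forall w, normc (g' w) <= 3 * B) ->
    wprob n (fun w => l < nrm (transform n a 0 g' w)) <= (3 * H * B / l) `^ q.
  move=> g'B; apply: le_trans (markov_wprob _ q0 l0 _) _ => [w|].
    exact: seminorm_ge0.
  apply: le_powR2r; rewrite ?(ltW q0) ?divr_ge0 ?wnorm_ge0 ?(ltW l0)//.
  rewrite ler_pM2r ?invr_gt0// [3 * H]mulrC -mulrA.
  by apply: bnd => //; rewrite mulr_ge0.
pose g' := reflected l n a 0 g.
apply: (@le_trans _ _ (wprob n (predU (fun w => l < nrm (transform n a 0 g w))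
    (fun w => l < nrm (transform n a 0 g' w))))).
  by apply: le_wprob => w; apply: transform_reflected_gt.
apply: le_trans (wprob_predU _ _ _ _) _; rewrite mulr_natl mulr2n lerD//.
  by apply: tail => w; apply: le_trans (gB w) _; lra.
by apply: tail => w; apply: normc_reflected.
Qed.

(* [g] replaced by its conditional mean from the first time at which the
   conditional mean of [`|g|] exceeds [k]. *)
Fixpoint stopped (k : R) n g w : R[i] :=
  if n is m.+1 then
    if k < wmean m.+1 (normc \o g) then wmean m.+1 g
    else stopped k m (g \o cons (head true w)) (behead w)
  else g [::].

Lemma stopped_cons k n g b : wmean n.+1 (normc \o g) <= k ->
  stopped k n.+1 g \o cons b = stopped k n (g \o cons b).
Proof. by move=> gk; apply/funext => w; rewrite [LHS]/= -wmeanS ltNge gk. Qed.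

Lemma wmean_stopped k n g : wmean n (stopped k n g) = wmean n g.
Proof.
elim: n g => // n IH g; have [gk|kg] := leP (wmean n.+1 (normc \o g)) k.
  by rewrite wmeanS !stopped_cons// !IH.
rewrite -[RHS](wmean_cst n.+1); apply: eq_wmean => w _.
by rewrite [LHS]/= -!wmeanS kg.
Qed.

Lemma normc_stopped k n g w : wmean n (normc \o g) <= 2 * k ->
  normc (stopped k n g w) <= 2 * k.
Proof.
elim: n g w => // n IH g w gk; rewrite [stopped _ _ _ _]/= -!wmeanS.
case: ltP => kg; first exact: le_trans (le_normc_wmean _ _) gk.
apply: IH; move: kg; rewrite wmeanS.
have half_ge0 b : 0 <= wmean n (normc \o (g \o cons b)).
  by apply: wmean_ge0 => w'; apply: normc_ge0.
by have := half_ge0 true; have := half_ge0 false; case: head; lra.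
Qed.

Lemma transform_max_stopped k n a v g w : doob_max n (normc \o g) w <= k ->
  transform_max n a v (stopped k n g) w = transform_max n a v g w.
Proof.
elim: n a v g w => // n IH a v g w; rewrite doob_maxS ge_max => /andP[gk gbk].
by rewrite !transform_maxS /transform_step stopped_cons// !wmean_stopped IH.
Qed.

Lemma wprob_transform_max_doob_le q H n a v g k l l' :
  0 < q -> 0 <= k -> 0 < l -> Loo_bounded q H n a -> nrm v + l <= l' ->
  wprob n (fun w =>
    (l' < transform_max n a v g w) && (doob_max n (normc \o g) w <= k)) <=
  2 * (6 * H * k / l) `^ q.
Proof.
move=> q0 k0 l0 bnd vl.
have [gk|kg] := leP (wmean n (normc \o g)) k; last first.
  rewrite wprob_pred0 ?mulr_ge0 ?powR_ge0// => w.
  by rewrite leNgt (lt_le_trans kg (le_wmean_doob_max _ _ _)) andbF.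
have -> : 6 * H * k / l = 3 * H * (2 * k) / l by ring.
have g2k w : normc (stopped k n g w) <= 2 * k by apply: normc_stopped; lra.
have k20 : 0 <= 2 * k by rewrite mulr_ge0.
apply: le_trans (weak_type_transform_max q0 k20 l0 bnd g2k).
apply: le_wprob => w /andP[l'T gk']; rewrite transform_max_stopped//.
by have := transform_maxD n a v 0 g w; rewrite addr0; lra.
Qed.

Lemma le_normc_wmean_increment n g b :
  normc (wmean n (g \o cons b) - wmean n.+1 g) <= wmean n.+1 (normc \o g).
Proof.
have -> : wmean n (g \o cons b) - wmean n.+1 g =
    (wmean n (g \o cons b) - wmean n (g \o cons (~~ b))) / 2.
  by rewrite wmeanS; case: b; field.
rewrite normcM normcV normc_nat wmeanS ler_pM2r ?invr_gt0//.
apply: le_trans (le_normcB _ _) _.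
apply: le_trans (lerD (le_normc_wmean _ _) (le_normc_wmean _ _)) _.
by case: b => //; rewrite addrC.
Qed.

Lemma le_seminorm_transform_step q H n a v g b : 0 < q ->
  Loo_bounded q H n.+1 a ->
  nrm (transform_step n a v g b) <= nrm v + H * wmean n.+1 (normc \o g).
Proof.
move=> q0 bnd; have [nrmD nrmZ] := nrm_seminorm.
apply: le_trans (nrmD _ _) _; rewrite lerD2l nrmZ mulrC ler_pM//.
- exact: seminorm_ge0.
- exact: normc_ge0.
- exact: Loo_bounded_coef bnd.
- exact: le_normc_wmean_increment.
Qed.

(* At the first time the transform exceeds [l] it is at most [2 * l], because
   its last jump is at most [H * k]; from then on the transform of the shifted
   coefficients has to gain another [l]. *)
Lemma transform_good_lambda q H n a v g k l :
  0 < q -> 0 <= k -> 0 < l -> H * k <= l ->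
  Loo_bounded q H n a -> nrm v <= l ->
  wprob n (fun w =>
    (3 * l < transform_max n a v g w) && (doob_max n (normc \o g) w <= k)) <=
  2 * (6 * H * k / l) `^ q * wprob n (fun w => l < transform_max n a v g w).
Proof.
move=> q0 k0 l0 Hkl; set c := 2 * _.
have cP_ge0 m E : 0 <= c * wprob m E by rewrite !mulr_ge0 ?powR_ge0 ?wprob_ge0.
elim: n a v g => [|n IH] a v g bnd vl.
  rewrite wprob_pred0 ?cP_ge0// => w.
  by rewrite ltNge (_ : nrm v <= 3 * l)//; lra.
have [gk|kg] := leP (wmean n.+1 (normc \o g)) k; last first.
  rewrite wprob_pred0 ?cP_ge0// => w.
  by rewrite (leNgt _ k) (lt_le_trans kg (le_wmean_doob_max _ _ _)) andbF.
rewrite !wprobS mulrA ler_pM2r ?invr_gt0// mulrDr.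
suff half b : wprob n (fun w => (3 * l < transform_max n.+1 a v g (b :: w)) &&
      (doob_max n.+1 (normc \o g) (b :: w) <= k)) <=
    c * wprob n (fun w => l < transform_max n.+1 a v g (b :: w)).
  by rewrite lerD//; apply: half.
set u := transform_step n a v g b; set gb := g \o cons b.
have bndS := Loo_bounded_shift bnd.
have gt_l w : (l < transform_max n.+1 a v g (b :: w)) =
    (l < transform_max n (a \o S) u gb w).
  by rewrite transform_maxS lt_max (ltNge _ (nrm v)) vl.
have gt_3l w : (3 * l < transform_max n.+1 a v g (b :: w)) &&
      (doob_max n.+1 (normc \o g) (b :: w) <= k) =
    (3 * l < transform_max n (a \o S) u gb w) &&
      (doob_max n (normc \o gb) w <= k).
  rewrite transform_maxS doob_maxS lt_max ge_max gk.
  by rewrite (ltNge _ (nrm v)) (_ : nrm v <= 3 * l)//; lra.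
rewrite (eq_wprob _ _ gt_l) (eq_wprob _ _ gt_3l).
have [ul|lu] := leP (nrm u) l; first exact: IH.
have -> : wprob n (fun w => l < transform_max n (a \o S) u gb w) = 1 :> R.
  apply: wprob_predT => w.
  exact: lt_le_trans lu (le_seminorm_transform_max _ _ _ _ _).
rewrite mulr1; apply: wprob_transform_max_doob_le => //.
have H0 : 0 <= H.
  exact: le_trans (seminorm_ge0 _ nrm_seminorm) (Loo_bounded_coef q0 bnd).
have := le_seminorm_transform_step v g b q0 bnd; have := ler_wpM2l H0 gk.
by rewrite -/u; lra.
Qed.

Lemma transform_max_le_doob_max q H n a g s eps :
  0 < q -> 0 < s -> 0 < eps -> H * eps <= 1 ->
  2 * (6 * H * eps) `^ q * 3 `^ s <= 2^-1 -> Loo_bounded q H n a ->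
  wnorm n s (transform_max n a 0 g) <=
  good_lambda_cst 3 s * (wnorm n s (doob_max n (normc \o g)) / eps).
Proof.
move=> q0 s0 eps0 Heps eps_small bnd.
apply: (good_lambda_wnorm_le _ _ _ _ _ eps0 eps_small) => //; first by lra.
- by move=> w; apply: transform_max_ge0.
- by move=> w; apply: doob_max_ge0 => w'; apply: normc_ge0.
- exact: transform_max_bounded.
move=> l l0; have -> : 6 * H * eps = 6 * H * (eps * l) / l.
  by field; rewrite gt_eqF.
apply: transform_good_lambda => //.
- by rewrite mulr_ge0 ?(ltW eps0) ?(ltW l0).
- by rewrite mulrA ler_piMl ?(ltW l0).
- by rewrite seminorm0// ltW.
Qed.

End Transform.

Theorem Loo_bounded_extrapolation (R : realType) (q s : R) : 0 < q -> 1 < s ->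
  exists2 K : R, 0 < K &
  forall (V : lmodType R[i]) (nrm : V -> R) n (a : nat -> V) H,
  seminorm nrm -> 0 < H -> Loo_bounded nrm q H n a ->
  forall g,
    wnorm n s (nrm \o transform n a 0 g) <= K * H * wnorm n s (normc \o g).
Proof.
move=> q0 s1; have s0 : 0 < s := lt_trans ltr01 s1.
have ts_gt0 : 0 < (3 : R) `^ s by rewrite powR_gt0.
have [|y /andP[y0 y1] y_small] := @exists_powR_le _ q (4 * 3 `^ s)^-1 q0.
  by rewrite invr_gt0 mulr_gt0.
pose K := good_lambda_cst 3 s.
have K0 : 0 < K by apply: good_lambda_cst_gt0 => //; lra.
exists (K * (6 / y) * (s / (s - 1))).
  by rewrite !mulr_gt0 ?invr_gt0 ?subr_gt0.
move=> V nrm n a H nrmP H0 bnd g; pose eps := y / (6 * H).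
have eps0 : 0 < eps by rewrite divr_gt0 ?mulr_gt0.
have Heps : 6 * H * eps = y by rewrite /eps; field; rewrite gt_eqF.
have Heps1 : H * eps <= 1 by move: Heps; rewrite -mulrA; lra.
have eps_small : 2 * (6 * H * eps) `^ q * 3 `^ s <= 2^-1.
  have := ler_wpM2r (ltW ts_gt0) y_small; rewrite invfM mulfVK ?gt_eqF// Heps.
  by lra.
apply: (@le_trans _ _ (wnorm n s (transform_max nrm n a 0 g))).
  apply: le_wnorm (ltW s0) _ => w.
  by rewrite seminorm_ge0//= seminorm_transform_le_max.
have := transform_max_le_doob_max nrmP g q0 s0 eps0 Heps1 eps_small bnd.
move=> /le_trans; apply.
have -> : K * (6 / y) * (s / (s - 1)) * H * wnorm n s (normc \o g) =
    K * (s / (s - 1) * wnorm n s (normc \o g) / eps).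
  by rewrite /eps; field; rewrite !gt_eqF ?subr_gt0.
rewrite ler_pM2l// ler_pM2r ?invr_gt0//.
by apply: doob_inequality => // w; apply: normc_ge0.
Qed.

(** * Complex-valued integrable functions *)

Section Integration.
Local Open Scope classical_set_scope.
Context d (T : measurableType d) (R : realType).
Variable mu : {measure set T -> \bar R}.
Implicit Types (D E : set T) (f : T -> R[i]) (u : T -> R) (p : R).

Import HBNNSimple.

(* [F] need not be measurable, which matters for functions about which nothing
   is known outside [D]. *)
Lemma ge0_integral_mrestr D (mD : measurable D) (F : T -> \bar R) :
  (forall x, 0 <= F x)%E ->
  (\int[mrestr mu mD]_x F x = \int[mu]_(x in D) F x)%E.
Proof.
move=> F0; set nu := mrestr mu mD.
transitivity (\int[nu]_(x in D) F x)%E; last first.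
  by apply: eq_measure_integral => A mA AD; exact: (congr1 mu (setIidl AD)).
apply/eqP; rewrite eq_le; apply/andP; split; last first.
  rewrite ge0_integralTE// ge0_integralE//.
  apply: ereal_sup_le => _ /= [g gF <-].
  by exists g => // x; apply: le_trans (gF x) _; rewrite patchE; case: ifP.
rewrite [leLHS]ge0_integralTE//; apply: ge_ereal_sup => _ /= [g gF <-].
have -> : sintegral nu g = (\int[nu]_(x in D) (g x)%:E)%E.
  transitivity (\int[nu]_x (g x)%:E)%E.
    by rewrite integral_nnsfun// patch_setT.
  rewrite (@ge0_negligible_integral _ _ _ nu setT (~` D))//.
  - by rewrite setTD setCK.
  - exact: measurableC.
  - by apply/measurable_EFinP; apply: measurable_funP.
  - by move=> x _; rewrite lee_fin.
  - by rewrite -(measure0 mu); exact: (congr1 mu (setICl _)).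
rewrite !ge0_integralE//; last by move=> x _; rewrite lee_fin.
apply: ereal_sup_le => _ /= [g' g'g <-]; exists g' => // x.
by apply: le_trans (g'g x) _; rewrite !patchE; case: ifP.
Qed.

Lemma integrable_cst D (c : R) : measurable D -> (mu D < +oo)%E ->
  mu.-integrable D (EFin \o (fun=> c)).
Proof.
move=> mD Dfin; apply: measurable_bounded_integrable => //.
by exists `|c|; split; [exact: num_real|move=> M cM x _; exact: ltW].
Qed.

Lemma jensen_Rintegral D p u : measurable D -> (0 < mu D < +oo)%E -> 1 <= p ->
  (forall x, 0 <= u x) -> mu.-integrable D (EFin \o u) ->
  mu.-integrable D (EFin \o (fun x => u x `^ p)) ->
  ((fine (mu D))^-1 * Rintegral mu D u) `^ p <=
  (fine (mu D))^-1 * Rintegral mu D (fun x => u x `^ p).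
Proof.
move=> mD /andP[D0 Dfin] p1 u0 ui upi; set m := _ * Rintegral mu D u.
have muD0 : 0 < fine (mu D) by rewrite fine_gt0// D0.
have m0 : 0 <= m by rewrite mulr_ge0 ?invr_ge0 ?Rintegral_ge0// ltW.
apply: powR_le_of_tangent => //.
have tangent : Rintegral mu D (fun x => p * m `^ (p - 1) * u x) <=
    Rintegral mu D (fun x => u x `^ p + (p - 1) * m `^ p).
  apply: le_Rintegral => //.
  - exact: (integrableZl mD (p * m `^ (p - 1)) ui).
  - exact: (integrableD mD upi (integrable_cst _ mD Dfin)).
  - by move=> x _; apply: powR_tangent.
move: tangent; rewrite RintegralZl// RintegralD//; last exact: integrable_cst.
rewrite Rintegral_cst// -(ler_pM2l (_ : 0 < (fine (mu D))^-1)) ?invr_gt0//.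
by rewrite mulrDr mulrCA -/m [_^-1 * (_ * _)]mulrC mulfK ?gt_eqF.
Qed.

Lemma measurable_normc D f :
  measurable_fun D (fun x => complex.Re (f x)) ->
  measurable_fun D (fun x => complex.Im (f x)) ->
  measurable_fun D (normc \o f).
Proof.
move=> fr fi.
have -> : normc \o f =
    fun x => (complex.Re (f x) ^+ 2 + complex.Im (f x) ^+ 2) `^ 2^-1.
  apply/funext => x; rewrite -sqr_normc_ReIm powR12_sqrt ?sqr_ge0//.
  by rewrite sqrtr_sqr ger0_norm ?normc_ge0.
apply: (measurableT_comp (measurable_powR _)).
by apply: measurable_funD; apply: measurable_funX.
Qed.

Definition cLp p D f : Prop :=
  [/\ measurable_fun D (fun x => complex.Re (f x)),
      measurable_fun D (fun x => complex.Im (f x)) &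
      mu.-integrable D (EFin \o (fun x => normc (f x) `^ p))].

Lemma cLpS D E p f : measurable D -> measurable E -> D `<=` E ->
  cLp p E f -> cLp p D f.
Proof.
move=> mD mE DE [fr fi fp]; split.
- exact: measurable_funS fr.
- exact: measurable_funS fi.
- exact: integrableS fp.
Qed.

Lemma cLp1_normc D f : cLp 1 D f -> mu.-integrable D (EFin \o (normc \o f)).
Proof.
case=> _ _; rewrite (_ : EFin \o (fun x => _) = EFin \o (normc \o f))//.
by apply/funext => x /=; rewrite powRr1 ?normc_ge0.
Qed.

Lemma cLp1_Re D f : measurable D -> cLp 1 D f ->
  mu.-integrable D (EFin \o (fun x => complex.Re (f x))).
Proof.
move=> mD fD; have [fr _ _] := fD; apply: le_integrable (cLp1_normc fD) => //.
  exact/measurable_EFinP.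
by move=> x _ /=; rewrite lee_fin [leRHS]ger0_norm ?normc_ge0 ?normr_Re_le.
Qed.

Lemma cLp1_Im D f : measurable D -> cLp 1 D f ->
  mu.-integrable D (EFin \o (fun x => complex.Im (f x))).
Proof.
move=> mD fD; have [_ fi _] := fD; apply: le_integrable (cLp1_normc fD) => //.
  exact/measurable_EFinP.
by move=> x _ /=; rewrite lee_fin [leRHS]ger0_norm ?normc_ge0 ?normr_Im_le.
Qed.

Lemma cLp_cLp1 D p f : measurable D -> (mu D < +oo)%E -> 1 <= p ->
  cLp p D f -> cLp 1 D f.
Proof.
move=> mD Dfin p1 [fr fi fp]; split => //.
have gi : mu.-integrable D (EFin \o (fun x => 1 + normc (f x) `^ p)).
  by apply: eq_integrable (integrableD mD (integrable_cst 1 mD Dfin) fp).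
apply: le_integrable gi => //.
  apply/measurable_EFinP; apply: (measurableT_comp (measurable_powR _)).
  exact: measurable_normc.
move=> x _ /=; rewrite lee_fin powRr1 ?normc_ge0//.
rewrite !ger0_norm ?addr_ge0 ?powR_ge0 ?normc_ge0//.
have [f1|/ltW f1] := leP (normc (f x)) 1.
  by rewrite (le_trans f1)// lerDl powR_ge0.
by rewrite (le_trans (le1r_powR f1 p1))// lerDr.
Qed.

End Integration.

Lemma le_normc_cintegral (R : realType) (D : set (measurableTypeR R))
    (f : R -> R[i]) :
  measurable D -> cLp lebesgue_measure 1 D f ->
  normc (cintegral D f) <= Rintegral lebesgue_measure D (normc \o f).
Proof.
move=> mD fD; set z := cintegral D f; have f1 := cLp1_normc fD.
have [fr fi] := (cLp1_Re mD fD, cLp1_Im mD fD).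
have : normc z * normc z <= normc z * Rintegral lebesgue_measure D (normc \o f).
  rewrite -expr2 sqr_normc_ReIm !expr2 -[X in X * _ + _]/(complex.Re z).
  rewrite -!RintegralZl// -RintegralD//; first last.
  - exact: (integrableZl mD _ fi).
  - exact: (integrableZl mD _ fr).
  apply: le_Rintegral => //.
  - exact: (integrableD mD (integrableZl mD _ fr) (integrableZl mD _ fi)).
  - exact: (integrableZl mD _ f1).
  - by move=> x _; apply: le_dot_normc.
have := normc_ge0 z; rewrite le_eqVlt => /predU1P[<- _|z0].
  by apply: Rintegral_ge0 => x _; apply: normc_ge0.
by rewrite ler_pM2l.
Qed.

(** * Dyadic intervals as binary words *)

Section DyadicWords.
Variable R : realType.
Local Notation mu := (@lebesgue_measure R).
Local Open Scope classical_set_scope.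
Implicit Types (n k i : nat) (x p : R) (f : R -> R[i]).

Definition dyadic_set k i : set (measurableTypeR R) :=
  [set` dyadic_itv R k i].

(* [true] stands for the left half. *)
Definition half_index i (b : bool) : nat := (i.*2 + ~~ b)%N.

Definition in_left_half k i x : bool := x < i.*2.+1%:R / 2 ^+ k.+1.

Fixpoint digits n k i x : seq bool :=
  if n is m.+1 then
    let b := in_left_half k i x in b :: digits m k.+1 (half_index i b) x
  else [::].

Let expr2_gt0 k : 0 < 2 ^+ k :> R. Proof. by rewrite exprn_gt0. Qed.

Lemma measurable_dyadic_set k i : measurable (dyadic_set k i).
Proof. exact: measurable_itv. Qed.

Lemma dyadic_setP k i x : dyadic_set k i x <-> (i%:R <= x * 2 ^+ k < i%:R + 1).
Proof.
by rewrite /dyadic_set /= in_itv/= ler_pdivrMr// ltr_pdivlMr// natr1.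
Qed.

Lemma dyadic_set00 : dyadic_set 0 0 = @Omega R.
Proof. by rewrite /dyadic_set /dyadic_itv expr0 !divr1. Qed.

Lemma dyadic_atomE k i x : dyadic_set k i x -> dyadic_atom k x = dyadic_set k i.
Proof.
move=> /dyadic_setP xi; rewrite /dyadic_atom (@floor_def _ _ (Posz i)).
  by rewrite /dyadic_set /dyadic_itv natr1.
by rewrite intrD.
Qed.

Lemma dyadic_set_half k i b x : dyadic_set k.+1 (half_index i b) x <->
  dyadic_set k i x /\ in_left_half k i x = b.
Proof.
have i2 : i.*2%:R = 2 * i%:R :> R by rewrite -muln2 natrM mulrC.
rewrite !dyadic_setP /in_left_half ltr_pdivlMr// exprS /half_index.
rewrite natrD -natr1 i2.
set y := x * 2 ^+ k; have -> : x * (2 * 2 ^+ k) = 2 * y by rewrite mulrCA.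
case: b => /=; rewrite ?addn0 ?addr0; split.
- by move=> /andP[? ?]; split; [apply/andP; split|]; lra.
- by move=> [/andP[? ?] ?]; apply/andP; split; lra.
- by move=> /andP[? ?]; split; [apply/andP; split|]; lra.
- by move=> [/andP[? ?] /negbT]; rewrite -leNgt => ?; apply/andP; split; lra.
Qed.

Lemma dyadic_set_half_subset k i b :
  dyadic_set k.+1 (half_index i b) `<=` dyadic_set k i.
Proof. by move=> x /dyadic_set_half[]. Qed.

Lemma dyadic_set_split k i : dyadic_set k i =
  dyadic_set k.+1 (half_index i true) `|` dyadic_set k.+1 (half_index i false).
Proof.
apply/seteqP; split=> x; last by case; apply: dyadic_set_half_subset.
by case xl : (in_left_half k i x) => xi; [left|right]; apply/dyadic_set_half.
Qed.

Lemma disjoint_dyadic_halves k i : [disjoint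
  dyadic_set k.+1 (half_index i true) & dyadic_set k.+1 (half_index i false)].
Proof.
apply/disj_setPS => x [] /dyadic_set_half[_ xl] /dyadic_set_half[_].
by rewrite xl.
Qed.

Lemma lebesgue_measure_dyadic_set k i : mu (dyadic_set k i) = (2 ^- k)%:E.
Proof.
rewrite /dyadic_set lebesgue_measure_itv/= lte_fin ltr_pM2r ?invr_gt0//.
rewrite ltr_nat ltnS leqnn -EFinB -mulrBl -[i.+1%:R]natr1.
by rewrite addrAC subrr add0r mul1r.
Qed.

Lemma measurable_digits n k i (phi : seq bool -> R) :
  measurable_fun (dyadic_set k i)
    (fun x : measurableTypeR R => phi (digits n k i x)).
Proof.
elim: n k i phi => [|n IH] k i phi /=; first exact: measurable_cst.
rewrite dyadic_set_split.
apply/measurable_funU; try exact: measurable_dyadic_set.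
by split; apply: eq_measurable_fun (IH _ _ (phi \o cons _)) => x;
  rewrite inE => /dyadic_set_half[_ /= ->].
Qed.

Lemma integral_digits n k i (phi : seq bool -> R) :
  (\int[mu]_(x in dyadic_set k i) (phi (digits n k i x))%:E =
   (2 ^- k * wmean n phi)%:E)%E.
Proof.
elim: n k i phi => [|n IH] k i phi.
  apply: etrans (integral_cst mu (measurable_dyadic_set k i) (phi [::])%:E) _.
  by rewrite [X in (_ * X)%E]lebesgue_measure_dyadic_set -EFinM mulrC.
have mphi : measurable_fun (dyadic_set k i)
    (fun x => (phi (digits n.+1 k i x))%:E).
  by apply/measurable_EFinP; apply: measurable_digits.
rewrite dyadic_set_split integral_setU -?dyadic_set_split//;
  [|exact: measurable_dyadic_set|exact: measurable_dyadic_set|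
    exact: disjoint_dyadic_halves].
have half b : (\int[mu]_(x in dyadic_set k.+1 (half_index i b))
    (phi (digits n.+1 k i x))%:E = (2 ^- k.+1 * wmean n (phi \o cons b))%:E)%E.
  rewrite -(IH _ (half_index i b)); apply: eq_integral => x.
  by rewrite inE => /dyadic_set_half[_ /= ->].
by rewrite !half -EFinD; congr EFin; rewrite /= exprS; field; rewrite gt_eqF.
Qed.

Lemma integrable_digits n k i (phi : seq bool -> R) :
  mu.-integrable (dyadic_set k i) (EFin \o (fun x => phi (digits n k i x))).
Proof.
apply/integrableP; split.
  by apply/measurable_EFinP; apply: measurable_digits.
by rewrite (integral_digits n k i (fun w => `|phi w|)) ltry.
Qed.

Lemma cLp_digits p n k i (g : seq bool -> R[i]) :
  cLp mu p (dyadic_set k i) (fun x => g (digits n k i x)).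
Proof.
have gi (r : R[i] -> R) := integrable_digits n k i (r \o g).
split; last exact: gi (fun z => normc z `^ p).
- by apply/measurable_EFinP; exact: measurable_int (gi (@complex.Re R)).
- by apply/measurable_EFinP; exact: measurable_int (gi (@complex.Im R)).
Qed.

Lemma cLp_half p k i b f :
  cLp mu p (dyadic_set k i) f -> cLp mu p (dyadic_set k.+1 (half_index i b)) f.
Proof.
apply: cLpS; [exact: measurable_dyadic_set|exact: measurable_dyadic_set|].
exact: dyadic_set_half_subset.
Qed.

Lemma Rintegral_dyadic_split k i (u : R -> R) :
  mu.-integrable (dyadic_set k i) (EFin \o u) ->
  Rintegral mu (dyadic_set k i) u =
  Rintegral mu (dyadic_set k.+1 (half_index i true)) u +
  Rintegral mu (dyadic_set k.+1 (half_index i false)) u.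
Proof.
move=> ui; rewrite dyadic_set_split Rintegral_setU -?dyadic_set_split//;
  [exact: measurable_dyadic_set|exact: measurable_dyadic_set|].
exact: disjoint_dyadic_halves.
Qed.

Definition dyadic_mean k i f : R[i] :=
  (2 ^+ k)%:C%C * cintegral (dyadic_set k i) f.

Lemma condE_dyadic_mean k i f x :
  dyadic_set k i x -> condE k f x = dyadic_mean k i f.
Proof. by move=> xi; rewrite /condE (dyadic_atomE xi). Qed.

Lemma dyadic_mean_cst k i f c : (forall x, dyadic_set k i x -> f x = c) ->
  dyadic_mean k i f = c.
Proof.
move=> fc; rewrite /dyadic_mean /cintegral.
have part (r : R[i] -> R) :
    Rintegral mu (dyadic_set k i) (fun x => r (f x)) = r c / 2 ^+ k.
  transitivity (Rintegral mu (dyadic_set k i) (fun=> r c)).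
    by apply: eq_Rintegral => x; rewrite inE => /fc ->.
  rewrite Rintegral_cst; last exact: measurable_dyadic_set.
  by rewrite [X in fine X]lebesgue_measure_dyadic_set.
rewrite !part; case: c {fc part} => a b; apply/eqP; rewrite eq_complex /=.
have mulKpow (y : R) : 2 ^+ k * (y / 2 ^+ k) = y.
  by rewrite mulrC divfK// gt_eqF.
by rewrite !mul0r subr0 addr0 !mulKpow !eqxx.
Qed.

Lemma dyadic_mean_split k i f : cLp mu 1 (dyadic_set k i) f ->
  dyadic_mean k i f = (dyadic_mean k.+1 (half_index i true) f +
                       dyadic_mean k.+1 (half_index i false) f) / 2.
Proof.
move=> fi; have mI := measurable_dyadic_set k i.
rewrite /dyadic_mean /cintegral.
rewrite (Rintegral_dyadic_split (cLp1_Re mI fi)).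
rewrite (Rintegral_dyadic_split (cLp1_Im mI fi)).
have complexD (a b c d : R) :
  ((a + b) +i* (c + d) = (a +i* c) + (b +i* d))%C by [].
have mean (a x y : R[i]) : a * (x + y) = (2 * a * x + 2 * a * y) / 2 by field.
by rewrite complexD exprS rmorphM/= rmorph_nat mean.
Qed.

Lemma normc_dyadic_mean_le p k i f : 1 <= p -> cLp mu p (dyadic_set k i) f ->
  normc (dyadic_mean k i f) `^ p <=
  2 ^+ k * Rintegral mu (dyadic_set k i) (fun x => normc (f x) `^ p).
Proof.
move=> p1 fp; have mI := measurable_dyadic_set k i.
have muI : fine (mu (dyadic_set k i)) = 2 ^- k.
  by rewrite [X in fine X]lebesgue_measure_dyadic_set.
have muI_pos : (0 < mu (dyadic_set k i) < +oo)%E.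
  by rewrite lebesgue_measure_dyadic_set ltry lte_fin invr_gt0 expr2_gt0.
have /andP[_ muI_fin] := muI_pos; have f1 := cLp_cLp1 mI muI_fin p1 fp.
have [_ _ fpi] := fp.
apply: le_trans (_ : _ <=
    (2 ^+ k * Rintegral mu (dyadic_set k i) (normc \o f)) `^ p) _.
  apply: le_powR2r; rewrite ?normc_ge0//; first by lra.
  rewrite normcM normc_real ger0_norm ?(ltW (expr2_gt0 k))//.
  by rewrite ler_pM2l ?expr2_gt0// le_normc_cintegral.
have := @jensen_Rintegral _ _ _ mu _ _ (normc \o f) mI muI_pos p1.
rewrite muI invrK; apply => //; first by move=> x; apply: normc_ge0.
exact: cLp1_normc.
Qed.

Fixpoint leaf_mean n k i f (w : seq bool) : R[i] :=
  if n is m.+1 then leaf_mean m k.+1 (half_index i (head true w)) f (behead w)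
  else dyadic_mean k i f.

Lemma leaf_mean_digits n k i f (phi : seq bool -> R[i]) :
  (forall x, dyadic_set k i x -> f x = phi (digits n k i x)) ->
  forall w, size w = n -> leaf_mean n k i f w = phi w.
Proof.
elim: n k i phi => [|n IH] k i phi fphi.
  by case=> //= _; apply: dyadic_mean_cst.
case=> // b w [wn] /=; apply: (IH _ _ (phi \o cons b)) => // x.
by move=> /dyadic_set_half[/fphi -> /= ->].
Qed.

Lemma wmean_leaf_mean n k i f : cLp mu 1 (dyadic_set k i) f ->
  wmean n (leaf_mean n k i f) = dyadic_mean k i f.
Proof.
elim: n k i => // n IH k i fi; rewrite (dyadic_mean_split fi).
by rewrite -!IH//; apply: cLp_half.
Qed.

Lemma wmean_normc_leaf_mean_le p n k i f :
  1 <= p -> cLp mu p (dyadic_set k i) f ->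
  wmean n (fun w => normc (leaf_mean n k i f w) `^ p) <=
  2 ^+ k * Rintegral mu (dyadic_set k i) (fun x => normc (f x) `^ p).
Proof.
move=> p1; elim: n k i => [|n IH] k i fp; first exact: normc_dyadic_mean_le.
have [_ _ fpi] := fp; rewrite (Rintegral_dyadic_split fpi) wmeanS.
have mean (a x y X Y : R) : X <= 2 * a * x -> Y <= 2 * a * y ->
    (X + Y) / 2 <= a * (x + y) by lra.
by apply: mean; rewrite -exprS; exact: IH (cLp_half _ fp).
Qed.

Lemma transform_leaf_mean (V : lmodType R[i]) n k i f (a : nat -> V) v x :
  cLp mu 1 (dyadic_set k i) f -> dyadic_set k i x ->
  transform n a v (leaf_mean n k i f) (digits n k i x) =
  v + \sum_(l < n) mdiff (k + l).+1 f x *: a l.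
Proof.
elim: n k i a v => [|n IH] k i a v fi xi; first by rewrite big_ord0 addr0.
set b := in_left_half k i x; have fb := cLp_half b fi.
have xb : dyadic_set k.+1 (half_index i b) x by apply/dyadic_set_half.
rewrite transformS [LHS](IH k.+1 (half_index i b))//.
rewrite /transform_step (wmean_leaf_mean n.+1 fi).
rewrite [wmean n _](wmean_leaf_mean n fb).
rewrite -(condE_dyadic_mean f xb) -(condE_dyadic_mean f xi).
rewrite big_ord_recl addn0 -addrA; congr (_ + (_ + _)).
by apply: eq_bigr => l _; rewrite lift0 addSnnS.
Qed.

End DyadicWords.

(** * Comparison of the constants *)

Section MaximalOperator.
Variable R : realType.
Local Open Scope classical_set_scope.
Local Notation mu := (@lebesgue_measure R).
Implicit Types (M N : nat) (p q C : R) (f : R -> R[i]).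

Definition max_normc M (v : 'cV[R[i]]_M) : R :=
  \big[Num.max/0]_(j < M) normc (v j 0).

Lemma max_normc_seminorm M : seminorm (@max_normc M).
Proof.
have ge0 (v : 'cV[R[i]]_M) : 0 <= max_normc v by apply: bigmax_ge_id.
split=> [u v|c v].
  apply: bigmax_le => [|j _]; first by rewrite addr_ge0.
  rewrite mxE (le_trans (le_normcD _ _))// lerD//.
    exact: (le_bigmax _ (fun j => normc (u j 0))).
  exact: (le_bigmax _ (fun j => normc (v j 0))).
rewrite /max_normc; under eq_bigr do rewrite mxE normcM.
elim/big_rec2: _ => [|j y1 y2 _ ->]; first by rewrite mulr0.
by rewrite maxr_pMr// normc_ge0.
Qed.

Definition columns M N (A : 'M[R[i]]_(M, N)) (l : nat) : 'cV[R[i]]_M :=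
  if insub l is Some k then col k A else 0.

Definition word_maxop M N (A : 'M[R[i]]_(M, N)) (g : seq bool -> R[i]) :
    seq bool -> R :=
  @max_normc M \o transform N (columns A) 0 g.

Lemma word_maxop_ge0 M N (A : 'M[R[i]]_(M, N)) g w : 0 <= word_maxop A g w.
Proof. exact/seminorm_ge0/max_normc_seminorm. Qed.

Lemma maxop_word_maxop M N (A : 'M[R[i]]_(M, N)) f x :
  cLp mu 1 (@Omega R) f -> Omega x ->
  maxop A f x = word_maxop A (leaf_mean N 0 0 f) (digits N 0 0 x).
Proof.
rewrite -dyadic_set00 => fi xO; rewrite /word_maxop /= transform_leaf_mean//.
rewrite add0r; apply: eq_bigr => j _; congr normc.
rewrite summxE; apply: eq_bigr => l _.
by rewrite add0n mxE /columns valK mxE mulrC.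
Qed.

Lemma LpnormE q (u : R -> R) :
  (Lpnorm q u = (\int[mu]_(x in @Omega R) (`|u x| `^ q)%:E) `^ q^-1)%E.
Proof. by rewrite /Lpnorm unlock /= ge0_integral_mrestr. Qed.

Lemma Lpnorm_digits N q (X : seq bool -> R) (u : R -> R) :
  (forall w, 0 <= X w) -> (forall x, Omega x -> u x = X (digits N 0 0 x)) ->
  Lpnorm q u = (wnorm N q X)%:E.
Proof.
move=> X0 uX; rewrite LpnormE -poweR_EFin; congr (_ `^ _)%E.
transitivity (\int[mu]_(x in dyadic_set 0 0) (X (digits N 0 0 x) `^ q)%:E)%E.
  rewrite dyadic_set00; apply: eq_integral => x; rewrite inE => /uX ->.
  by rewrite ger0_norm.
by rewrite (integral_digits N 0 0 (fun w => X w `^ q)) expr0 invr1 mul1r.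
Qed.

Lemma Lpnorm_maxop M N (A : 'M[R[i]]_(M, N)) q f : cLp mu 1 (@Omega R) f ->
  Lpnorm q (maxop A f) = (wnorm N q (word_maxop A (leaf_mean N 0 0 f)))%:E.
Proof.
move=> fi; apply: Lpnorm_digits => [w|x]; first exact: word_maxop_ge0.
exact: maxop_word_maxop.
Qed.

Lemma inLp_cLp p f : 0 < p -> inLp p f -> cLp mu p (@Omega R) f.
Proof.
move=> p0 [fr fi fp]; split=> //; apply/integrableP; split.
  apply/measurable_EFinP; apply: (measurableT_comp (measurable_powR _)).
  exact: measurable_normc fr fi.
move: fp; rewrite LpnormE => /(poweR_lty p).
rewrite -poweRrM mulVf ?gt_eqF// poweRe1; last first.
  by apply: integral_ge0 => x _; rewrite lee_fin powR_ge0.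
congr (_ < _)%E; apply: eq_integral => x _ /=.
by rewrite (ger0_norm (normc_ge0 _)) ger0_norm ?powR_ge0.
Qed.

Lemma Lpnorm_normc p f : cLp mu p (@Omega R) f -> Lpnorm p (normc \o f) =
  (Rintegral mu (@Omega R) (fun x => normc (f x) `^ p) `^ p^-1)%:E.
Proof.
move=> [_ _ fp]; rewrite LpnormE -poweR_EFin; congr (_ `^ _)%E.
rewrite /Rintegral fineK; last first.
  by apply: integrable_fin_num fp; exact: measurable_Omega.
by apply: eq_integral => x _; rewrite /= (ger0_norm (normc_ge0 _)).
Qed.

Lemma wnorm_leaf_mean_le N p f : 1 <= p -> cLp mu p (@Omega R) f ->
  ((wnorm N p (normc \o leaf_mean N 0 0 f))%:E <= Lpnorm p (normc \o f))%E.
Proof.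
move=> p1 fp; rewrite (Lpnorm_normc fp) lee_fin.
apply: le_powR2r; rewrite ?invr_ge0 ?wmean_powR_ge0//; first by lra.
rewrite -dyadic_set00 in fp *; have := wmean_normc_leaf_mean_le N p1 fp.
by rewrite expr0 mul1r.
Qed.

Lemma admissible_Loo_bounded p q M N (A : 'M[R[i]]_(M, N)) C : 0 < p -> 0 < q ->
  admissible p q A C -> Loo_bounded (@max_normc M) q C N (columns A).
Proof.
move=> p0 q0 [C0 adm] g B B0 gB; pose f (x : R) := g (digits N 0 0 x).
have fLp r : cLp mu r (@Omega R) f by rewrite -dyadic_set00; apply: cLp_digits.
have norm_f : Lpnorm p (fun x => normc (f x)) = (wnorm N p (normc \o g))%:E.
  by apply: Lpnorm_digits => // w; apply: normc_ge0.
have f_inLp : inLp p f by have [? ? _] := fLp p; split; rewrite ?norm_f ?ltry.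
have leaf_f w : size w = N -> leaf_mean N 0 0 f w = g w.
  exact: leaf_mean_digits.
have word_maxop_f :
    wnorm N q (word_maxop A (leaf_mean N 0 0 f)) = wnorm N q (word_maxop A g).
  apply: eq_wnorm => w wN.
  by rewrite /word_maxop /= (eq_transform _ _ leaf_f wN).
have := adm _ f_inLp.
rewrite (Lpnorm_maxop A q (fLp 1)) word_maxop_f norm_f -EFinM lee_fin => le_C.
rewrite -/(word_maxop A g); apply: le_trans le_C (ler_wpM2l C0 _).
have <- : wnorm N p (fun=> B) = B by rewrite wnorm_cst ?gt_eqF.
by apply: le_wnorm => [|w]; rewrite ?(ltW p0) ?normc_ge0 ?gB.
Qed.

Lemma admissible_of_Loo_bounded q0 p q : 0 < q0 -> 1 < p -> 0 < q -> q <= p ->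
  exists2 K : R, 0 < K & forall M N (A : 'M[R[i]]_(M, N)) C, 0 < C ->
    Loo_bounded (@max_normc M) q0 C N (columns A) -> admissible p q A (K * C).
Proof.
move=> q0_gt0 p1 q_gt0 qp; have p0 : 0 < p by lra.
have [K K0 extrapolation] := Loo_bounded_extrapolation q0_gt0 p1.
exists K => // M N A C C0 bnd; split; first by rewrite mulr_ge0 ?ltW.
move=> f /(inLp_cLp p0) fp.
have f1 : cLp mu 1 (@Omega R) f.
  rewrite -dyadic_set00 in fp *; apply: (cLp_cLp1 _ _ (ltW p1) fp).
    exact: measurable_dyadic_set.
  by rewrite [X in (X < _)%E]lebesgue_measure_dyadic_set ltry.
rewrite (Lpnorm_maxop _ _ f1).
apply: (@le_trans _ _ ((K * C) * wnorm N p (normc \o leaf_mean N 0 0 f))%:E)%E.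
  rewrite lee_fin.
  apply: le_trans (extrapolation _ _ _ _ _ (@max_normc_seminorm M) C0 bnd _).
  by apply: le_wnorm_exponent => // w; apply: word_maxop_ge0.
rewrite EFinM lee_wpmul2l ?lee_fin ?mulr_ge0 ?(ltW K0) ?(ltW C0)//.
exact: wnorm_leaf_mean_le (ltW p1) fp.
Qed.

Lemma hpq_ge0 p q M N (A : 'M[R[i]]_(M, N)) : (0 <= hpq p q A)%E.
Proof. by apply/ereal_infP => _ [C [C0 _] <-]; rewrite lee_fin. Qed.

(* The constant [0] may be admissible, hence the detour through [C + e]. *)
Lemma hpq_extrapolation p0 q0 p q :
  0 < p0 -> 0 < q0 -> 1 < p -> 0 < q -> q <= p ->
  exists2 K : R, 0 < K & forall M N (A : 'M[R[i]]_(M, N)),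
    (hpq p q A <= K%:E * hpq p0 q0 A)%E.
Proof.
move=> p0_gt0 q0_gt0 p1 q_gt0 qp.
have [K K0 adm_of_bnd] := admissible_of_Loo_bounded q0_gt0 p1 q_gt0 qp.
exists K => // M N A; rewrite -lee_pdivrMl//.
apply/ereal_infP => _ [C adm <-]; have [C0 _] := adm.
apply/lee_addgt0Pr => e e0; rewrite lee_pdivrMl// -EFinD -EFinM.
apply: ereal_inf_lbound; exists (K * (C + e)) => //.
apply: adm_of_bnd; first by rewrite ltr_wpDl.
apply: Loo_boundedW (admissible_Loo_bounded p0_gt0 q0_gt0 adm).
by rewrite lerDl ltW.
Qed.

End MaximalOperator.

Theorem theorem2p2 (R : realType) (p q : R) :
  1 < p -> 0 < q -> q < p ->
  exists C : R, 0 < C /\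
    forall (M N : nat) (A : 'M[R[i]]_(M, N)),
      ((C^-1)%:E * h A <= hpq p q A /\ hpq p q A <= C%:E * h A)%E.
Proof.
move=> p1 q0 qp; have p0 : 0 < p := lt_trans ltr01 p1.
have two_gt0 : 0 < 2 :> R by []; have two_gt1 : 1 < 2 :> R by rewrite ltr1n.
have [K K0 hpq_le] := hpq_extrapolation two_gt0 two_gt0 p1 q0 (ltW qp).
have [K' K'0 h_le] := hpq_extrapolation p0 q0 two_gt1 two_gt0 (lexx _).
exists (Num.max K K'); have C0 : 0 < Num.max K K' by rewrite lt_max K0.
split=> // M N A; split.
  rewrite lee_pdivrMl//; apply: le_trans (h_le M N A) _.
  by rewrite lee_wpmul2r ?hpq_ge0// lee_fin le_max lexx orbT.
apply: le_trans (hpq_le M N A) _.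
by rewrite lee_wpmul2r ?hpq_ge0// lee_fin le_max lexx.
Qed.
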